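(* Let $f:M\to N$ be a surjective homomorphism of common meadows such that the restriction $f_L=f|_{0\cdot M}:0\cdot M\to 0\cdot N$ is an isomorphism of lattices (an order isomorphism). Then $M/\mathrm{Ker}^R(f)$ is a common meadow, and the map $\overline f:M/\mathrm{Ker}^R(f)\to N$ defined by $\overline f(x+\mathrm{Ker}^R(f))=f(x)$ (and $\overline f(\mathbf{a})=\mathbf{a}$) is an isomorphism of meadows.
   Context: A common meadow is a set $M$ with constants $0,1,\mathbf{a}$, binary operations $+,\cdot$ and unary operations $-$ and $(\cdot)^{-1}$ such that for all $x,y,z\in M$: $(x+y)+z=x+(y+z)$; $x+y=y+x$; $x+0=x$; $x+(-x)=0\cdot x$; $(x\cdot y)\cdot z=x\cdot(y\cdot z)$; $x\cdot y=y\cdot x$; $1\cdot x=x$; $x\cdot(y+z)=x\cdot y+x\cdot z$; $-(-x)=x$; $x\cdot x^{-1}=1+0\cdot x^{-1}$; $(x\cdot y)^{-1}=x^{-1}\cdot y^{-1}$; $(1+0\cdot x)^{-1}=1+0\cdot x$; $0^{-1}=\mathbf{a}$; $x+\mathbf{a}=\mathbf{a}$. $0\cdot M=\{0\cdot x\mid x\in M\}$ is partially ordered by $z\leq z'$ iff $z\cdot z'=z$; for $z\in 0\cdot M$, $M_z=\{x\in M\mid 0\cdot x=z\}$ is a commutative ring with zero $z$ and identity $1+z$. A homomorphism of meadows is a map $f$ with $f(x+y)=f(x)+f(y)$, $f(x\cdot y)=f(x)\cdot f(y)$, $f(1)=1$ (not required to commute with inverses); an isomorphism is a bijective homomorphism.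 $\mathrm{Ker}^R(f)=\{x\in M\mid f(x)=0\cdot f(x)\}$, which is an ideal of $M$, where an ideal is a subset $I\subseteq M$ with $0\in I$ and $-x,x+y,x\cdot r\in I$ for $x,y\in I$, $r\in M$. For an ideal $I$ let $K=\{z\in 0\cdot M\mid I\cap M_z=M_z\}$ and $$M/I=\Big(\bigsqcup_{z\in 0\cdot M\setminus K}M_z/(I\cap M_z)\Big)\sqcup\{\mathbf{a}\},$$ with operations: for $x\in M_z$, $y\in M_{z'}$, $z,z'\notin K$, the sum (product) of $x+I\cap M_z$ and $y+I\cap M_{z'}$ is $(x+y)+(I\cap M_{z\cdot z'})$ (respectively $(x\cdot y)+(I\cap M_{z\cdot z'})$) if $z\cdot z'\notin K$ and $\mathbf{a}$ if $z\cdot z'\in K$; sums and products with $\mathbf{a}$ equal $\mathbf{a}$; $-(x+I\cap M_z)=(-x)+I\cap M_z$, $-\mathbf{a}=\mathbf{a}$; zero and one are the classes of $0$ and $1$ (or $\mathbf{a}$ if $0\in K$). Here $x+I$ denotes $x+I\cap M_{0\cdot x}$. Saying that $M/I$ is a common meadow means that there is an inverse operation making it one. *)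

(* Defs.v *)
From mathcomp Require Import all_boot.
From mathcomp Require Import boolp classical_sets functions.

Set Implicit Arguments.
Unset Strict Implicit.
Unset Printing Implicit Defensive.

Local Open Scope classical_set_scope.

Declare Scope meadow_scope.
Delimit Scope meadow_scope with M.

(* The inverse is kept out of the signature: homomorphisms ignore it, and the
   quotient [M/I] only comes with the other operations. *)
Record meadowOps := MeadowOps {
  carrier :> Type;
  mzero : carrier;
  mone : carrier;
  merr : carrier;
  madd : carrier -> carrier -> carrier;
  mmul : carrier -> carrier -> carrier;
  mopp : carrier -> carrier
}.

Arguments mzero {m}.
Arguments mone {m}.
Arguments merr {m}.

Notation "0" := mzero : meadow_scope.
Notation "1" := mone : meadow_scope.
Notation "'\a'" := merr (at level 0) : meadow_scope.
Notation "x + y" := (madd x y) : meadow_scope.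
Notation "x * y" := (mmul x y) : meadow_scope.
Notation "- x" := (mopp x) : meadow_scope.

Local Open Scope meadow_scope.

Record is_common_meadow (M : meadowOps) (inv : M -> M) : Prop := IsCommonMeadow {
  maddA : forall x y z : M, (x + y) + z = x + (y + z);
  maddC : forall x y : M, x + y = y + x;
  maddx0 : forall x : M, x + 0 = x;
  maddxN : forall x : M, x + - x = 0 * x;
  mmulA : forall x y z : M, (x * y) * z = x * (y * z);
  mmulC : forall x y : M, x * y = y * x;
  mmul1x : forall x : M, 1 * x = x;
  mmulDr : forall x y z : M, x * (y + z) = x * y + x * z;
  moppK : forall x : M, - - x = x;
  mmulxV : forall x : M, x * inv x = 1 + 0 * inv x;
  minvM : forall x y : M, inv (x * y) = inv x * inv y;
  minv1D0 : forall x : M, inv (1 + 0 * x) = 1 + 0 * x;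
  minv0 : inv 0 = \a;
  maddxa : forall x : M, x + \a = \a
}.

Record commonMeadow := CommonMeadow {
  cm_ops :> meadowOps;
  cm_inv : cm_ops -> cm_ops;
  cmP : is_common_meadow cm_inv
}.

(* [zeros M] is 0 * M, and [fiber z] is M_z. *)
Definition zeros (M : meadowOps) : set M := range (fun x : M => 0 * x).

Definition mle (M : meadowOps) (z z' : M) : Prop := z * z' = z.

Definition fiber (M : meadowOps) (z : M) : set M := [set x | 0 * x = z].

Arguments zeros M : clear implicits.

Record is_hom (M N : meadowOps) (f : M -> N) : Prop := IsHom {
  homD : forall x y, f (x + y) = f x + f y;
  homM : forall x y, f (x * y) = f x * f y;
  hom1 : f 1 = 1
}.

Definition is_iso (M N : meadowOps) (f : M -> N) : Prop :=
  is_hom f /\ bijective f.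

Definition zeros_order_iso (M N : meadowOps) (f : M -> N) : Prop :=
  set_bij (zeros M) (zeros N) f /\
  (forall z z', zeros M z -> zeros M z' -> (mle z z' <-> mle (f z) (f z'))).

Definition KerR (M N : meadowOps) (f : M -> N) : set M :=
  [set x | f x = 0 * f x].

Record is_ideal (M : meadowOps) (I : set M) : Prop := IsIdeal {
  ideal0 : I 0;
  idealN : forall x, I x -> I (- x);
  idealD : forall x y, I x -> I y -> I (x + y);
  idealM : forall x r, I x -> I (x * r)
}.

Section Quotient.
Variables (M : meadowOps) (I : set M).

(* K: the z such that the whole of M_z lies in I. *)
Definition collapsed : set M :=
  [set z | zeros M z /\ I `&` fiber z = fiber z].

Definition coset (x : M) : set M :=
  [set x + i | i in I `&` fiber (0 * x)].

(* Disjoint union of the M_z / (I `&` M_z), z in 0 * M minus K: the pairs of an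
   index z and a coset of an element of M_z. *)
Record cosetIn := CosetIn {
  cidx : M;
  cset : set M;
  cidxP : (zeros M `\` collapsed) cidx;
  csetP : exists2 x, fiber cidx x & coset x = cset
}.

Lemma cls_idxP (x : M) (hx : ~ collapsed (0 * x)) :
  (zeros M `\` collapsed) (0 * x).
Proof. by split=> //; exists x. Qed.

Lemma cls_setP (x : M) : exists2 y, fiber (0 * x) y & coset y = coset x.
Proof. by exists x. Qed.

(* The class of [x], or the extra point [None] if 0 * x belongs to K. *)
Definition cls (x : M) : option cosetIn :=
  match pselect (collapsed (0 * x)) with
  | left _ => None
  | right hx => Some (CosetIn (cls_idxP hx) (cls_setP x))
  end.

Definition cosetRepr (c : cosetIn) : M := s2val (cid2 (csetP c)).

(* Sums and products are computed on chosen representatives; [cls_add], [cls_mul]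
   and [cls_opp] below show that the choice is irrelevant for ideals of common
   meadows. By [cm_mul0D] and [cm_mul0M], 0 * (x + y) = 0 * (x * y) =
   (0 * x) * (0 * y), so [cls] returns the extra point exactly when the product
   of the two indices is in K. *)
Definition quot_op2 (op : M -> M -> M) (u v : option cosetIn) :
    option cosetIn :=
  if (u, v) is (Some c, Some d) then cls (op (cosetRepr c) (cosetRepr d))
  else None.

Definition quot : meadowOps := {|
  carrier := option cosetIn;
  mzero := cls 0;
  mone := cls 1;
  merr := None;
  madd := quot_op2 (@madd M);
  mmul := quot_op2 (@mmul M);
  mopp := fun u => if u is Some c then cls (- cosetRepr c) else None
|}.

End Quotient.

Section CommonMeadowTheory.
Variable M : commonMeadow.
Implicit Types (x y z : M) (I : set M).
Let P := cmP M.

Lemma cm_add0x x : 0 + x = x.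
Proof. by rewrite (maddC P) (maddx0 P). Qed.

Lemma cm_mulx1 x : x * 1 = x.
Proof. by rewrite (mmulC P) (mmul1x P). Qed.

Lemma cm_mulDl x y z : (x + y) * z = x * z + y * z.
Proof. by rewrite (mmulC P) (mmulDr P) (mmulC P z) (mmulC P z). Qed.

Lemma cm_add_x0x x : x + 0 * x = x.
Proof. by rewrite -{1}(mmul1x P x) -cm_mulDl (maddx0 P) (mmul1x P). Qed.

Lemma cm_mul00 : 0 * 0 = 0 :> M.
Proof. by rewrite -[LHS]cm_add0x cm_add_x0x. Qed.

Lemma cm_mul00x x : 0 * (0 * x) = 0 * x.
Proof. by rewrite -(mmulA P) cm_mul00. Qed.

Lemma cm_add00 x : 0 * x + 0 * x = 0 * x.
Proof. by rewrite -{2}[0 * x]cm_mul00x cm_add_x0x. Qed.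

Lemma cm_mulACA x y z (t : M) : (x * y) * (z * t) = (x * z) * (y * t).
Proof. by rewrite !(mmulA P) -(mmulA P y) (mmulC P y) (mmulA P z). Qed.

Lemma cm_addACA x y z (t : M) : (x + y) + (z + t) = (x + z) + (y + t).
Proof. by rewrite !(maddA P) -(maddA P y) (maddC P y) (maddA P z). Qed.

Lemma cm_mul0M x y : 0 * (x * y) = (0 * x) * (0 * y).
Proof. by rewrite cm_mulACA cm_mul00. Qed.

Lemma cm_add0M x y : 0 * x + 0 * (x * y) = 0 * (x * y).
Proof.
have -> : 0 * x + 0 * (x * y) = x * (0 * (1 + y)).
  by rewrite -[RHS](mmulA P) (mmulC P x 0) (mmulDr P) cm_mulx1 (mmulA P).
by rewrite (mmulDr P) cm_mulx1 cm_add0x -(mmulA P) (mmulC P x) (mmulA P).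
Qed.

Lemma cm_mul0xx x : 0 * (x * x) = 0 * x.
Proof.
have E : (1 + 0 * x) * (1 + 0 * x) = 1 + 0 * (1 + 0 * x).
  by have := mmulxV P (1 + 0 * x); rewrite (minv1D0 P).
move: (congr1 (mmul 0) E).
rewrite cm_mulDl (mmul1x P) !(mmulDr P) !cm_mulx1 -cm_mul0M !cm_mul00x.
by rewrite !cm_add0x cm_mul00 ?cm_add0x !cm_add0M.
Qed.

Lemma cm_mul0D x y : 0 * (x + y) = 0 * (x * y).
Proof.
rewrite -cm_mul0xx cm_mulDl !(mmulDr P) !cm_mul0xx (mmulC P y x).
rewrite (maddC P (0 * (x * y)) (0 * y)) (maddA P) -(maddA P (0 * (x * y))).
have B : 0 * y + 0 * (x * y) = 0 * (x * y) by rewrite (mmulC P x y) cm_add0M.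
by rewrite (maddA P (0 * (x * y))) B cm_add00 cm_add0M.
Qed.

Lemma cm_mul0N x : 0 * - x = 0 * x.
Proof. by rewrite -!(maddxN P) (moppK P) (maddC P). Qed.

Lemma cm_opp_uniq x y : 0 * y = 0 * x -> x + y = 0 * x -> y = - x.
Proof.
move=> e0 e; rewrite -[RHS]cm_add_x0x cm_mul0N -e -(maddA P) [- x + x](maddC P).
by rewrite (maddxN P) -e0 (maddC P) cm_add_x0x.
Qed.

Lemma cm_oppD x y : - (x + y) = - x + - y.
Proof.
apply/esym/cm_opp_uniq.
  by rewrite !cm_mul0D !cm_mul0M !cm_mul0N.
by rewrite cm_addACA !(maddxN P) (mmulDr P).
Qed.

Section Ideal.
Variables (I : set M) (hI : is_ideal I).

Lemma coset_self x : coset I x x.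
Proof.
exists (0 * x); last exact: cm_add_x0x.
by split; [exact/(idealM hI)/(ideal0 hI) | exact: cm_mul00x].
Qed.

Lemma coset_shift x i : I i -> 0 * i = 0 * x -> coset I (x + i) = coset I x.
Proof.
move=> Ii ei.
have e : 0 * (x + i) = 0 * x by rewrite (mmulDr P) ei cm_add00.
rewrite /coset e; apply/seteqP; split=> _ [j [Ij ej] <-].
  exists (i + j); last by rewrite (maddA P).
  by split; [exact: (idealD hI) | rewrite /fiber /= (mmulDr P) ei ej cm_add00].
exists (j + - i); last first.
  rewrite (maddC P j) -(maddA P) (maddA P x) (maddxN P) ei cm_add_x0x.
  by [].
split; first exact/(idealD hI)/(idealN hI).
by rewrite /fiber /= (mmulDr P) cm_mul0N ei ej cm_add00.
Qed.

Lemma clsE x y : 0 * x = 0 * y -> coset I x = coset I y -> cls I x = cls I y.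
Proof.
move=> e0 e; rewrite /cls.
case: pselect => hx; case: pselect => hy //.
- by case: hy; rewrite -e0.
- by case: hx; rewrite e0.
congr Some; move: (cls_idxP hx) (cls_setP I x) (cls_idxP hy) (cls_setP I y).
by rewrite e0 e => p q p' q'; congr CosetIn; exact: Prop_irrelevance.
Qed.

Lemma cls_collapsed x : collapsed I (0 * x) -> cls I x = None.
Proof. by rewrite /cls; case: pselect. Qed.

Lemma cls_repr x : ~ collapsed I (0 * x) ->
  exists2 c, cls I x = Some c &
    exists2 i, I i /\ 0 * i = 0 * x & cosetRepr c = x + i.
Proof.
rewrite /cls; case: pselect => // h _; eexists; first by [].
rewrite /cosetRepr; case: cid2 => /= y; rewrite /fiber /= => ey ec.
have := coset_self y; rewrite ec => -[i [Ii ei] <-].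
by exists i.
Qed.

Lemma cls_add x y : ~ collapsed I (0 * x) -> ~ collapsed I (0 * y) ->
  (cls I x : quot I) + cls I y = cls I (x + y).
Proof.
move=> hx hy; have [c ec [i [Ii ei] rc]] := cls_repr hx.
have [d ed [j [Ij ej] rd]] := cls_repr hy.
rewrite /= /quot_op2 ec ed rc rd cm_addACA.
have ek : 0 * (i + j) = 0 * (x + y) by rewrite !(mmulDr P) ei ej.
apply: clsE; first by rewrite (mmulDr P) ek cm_add00.
by apply: coset_shift => //; apply: (idealD hI).
Qed.

Lemma cls_mul x y : ~ collapsed I (0 * x) -> ~ collapsed I (0 * y) ->
  (cls I x : quot I) * cls I y = cls I (x * y).
Proof.
move=> hx hy; have [c ec [i [Ii ei] rc]] := cls_repr hx.
have [d ed [j [Ij ej] rd]] := cls_repr hy.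
rewrite /= /quot_op2 ec ed rc rd cm_mulDl !(mmulDr P) (maddA P).
have ek : 0 * (x * j + (i * y + i * j)) = 0 * (x * y).
  by rewrite !(mmulDr P) !cm_mul0M ei ej -!cm_mul0M !cm_add00.
apply: clsE; first by rewrite (mmulDr P) ek cm_add00.
apply: coset_shift => //.
apply: (idealD hI); first by rewrite (mmulC P); apply: (idealM hI).
by apply: (idealD hI); apply: (idealM hI).
Qed.

Lemma cls_opp x : ~ collapsed I (0 * x) -> - (cls I x : quot I) = cls I (- x).
Proof.
move=> hx; have [c ec [i [Ii ei] rc]] := cls_repr hx.
rewrite /= ec rc cm_oppD.
have ek : 0 * - i = 0 * - x by rewrite !cm_mul0N.
apply: clsE; first by rewrite (mmulDr P) ek cm_add00.
by apply: coset_shift => //; apply: (idealN hI).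
Qed.

End Ideal.

End CommonMeadowTheory.

Section KernelIdeal.
Variables (M N : commonMeadow) (f : M -> N) (hf : is_hom f).

Lemma hom_zero : f 0 = 0.
Proof.
have e : 1 + f 0 = 1 by rewrite -(hom1 hf) -(homD hf) (maddx0 (cmP M)).
have := congr1 (fun u : N => mopp 1 + u) e.
rewrite -(maddA (cmP N)) (maddC (cmP N) (mopp 1)) (maddxN (cmP N)) cm_mulx1.
by rewrite cm_add0x.
Qed.

Lemma hom_opp x : f (- x) = - f x.
Proof.
apply: cm_opp_uniq.
  by rewrite -hom_zero -!(homM hf) cm_mul0N.
by rewrite -(homD hf) (maddxN (cmP M)) (homM hf) hom_zero.
Qed.

Lemma KerR_ideal : is_ideal (KerR f).
Proof.
split; rewrite /KerR /=.
- by rewrite hom_zero cm_mul00.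
- move=> x e; rewrite hom_opp cm_mul0N -e; apply/esym/cm_opp_uniq => //.
  by rewrite e cm_add00 cm_mul00x.
- by move=> x y ex ey; rewrite (homD hf) {1}ex {1}ey -(mmulDr (cmP N)).
- by move=> x r ex; rewrite (homM hf) {1}ex (mmulA (cmP N)).
Qed.

End KernelIdeal.

(* Main.v *)
(* Since [1 + z] lies in M_z, a zero z is collapsed exactly when f z = \a: the
   identity 1 + f z = f z forces f z = \a, on inverting 0 * f z. Hence
   x + Ker |-> f x is well defined and preserves the operations even when some
   class involved is the extra point. It is injective because f x = f y gives
   f (0 * x) = f (0 * y), so x and y lie in the same M_z and x - y is in Ker.
   The inverse of the quotient is transported from N along this bijection. *)
Require Import Defs.
From mathcomp Require Import all_boot.
From mathcomp Require Import boolp classical_sets functions.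

Local Open Scope meadow_scope.

Section ErrorElement.
Context {M : commonMeadow}.
Implicit Types x : M.
Let P := cmP M.

Lemma cm_addax x : \a + x = \a.
Proof. by rewrite (maddC P) (maddxa P). Qed.

Lemma cm_mul0a : 0 * \a = \a :> M.
Proof. by rewrite -(maddxN P) cm_addax. Qed.

(** Write [\a] as [0 * \a]; since [0 * (x * \a) = 0 * (x + \a)], absorption under sums gives
    absorption under products. *)
Lemma cm_mulxa x : x * \a = \a.
Proof.
rewrite -{1}cm_mul0a -(mmulA P) (mmulC P x) (mmulA P) -cm_mul0D (maddxa P).
exact: cm_mul0a.
Qed.

Lemma cm_mulax x : \a * x = \a.
Proof. by rewrite (mmulC P) cm_mulxa. Qed.

Lemma cm_oppa : - \a = \a :> M.
Proof. by apply/esym/cm_opp_uniq; rewrite // cm_addax cm_mul0a. Qed.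

Lemma cm_mul0x_eqa x : (0 * x = \a) <-> (x = \a).
Proof.
split=> [e|->]; last exact: cm_mul0a.
by rewrite -(cm_add_x0x x) e (maddxa P).
Qed.

(** [1 + 0 * x] is its own inverse, whereas the inverse of [0 * x] has the absorbing factor [\a],
    the inverse of [0]. *)
Lemma cm_add1_mul0_eqa x : 1 + 0 * x = 0 * x -> 0 * x = \a.
Proof.
move=> e; rewrite -{1}e -(minv1D0 P) e (minvM P) (minv0 P).
exact: cm_mulax.
Qed.

End ErrorElement.

(** Compatibility with [0], [\a] and [-] is assumed separately: [is_hom] omits it, and [Q] is not
    yet known to be a common meadow. *)
Lemma transport_common_meadow (Q : meadowOps) (N : commonMeadow) (g : Q -> N) :
    is_iso g -> g 0 = 0 -> g \a = \a -> (forall u, g (- u) = - g u) ->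
  exists inv : Q -> Q, is_common_meadow inv.
Proof.
move=> [[gD gM g1] [h gK hK]] g0 ga gN.
have I := can_inj gK; have P := cmP N.
exists (fun u => h (cm_inv (g u))); split=> *; apply: I;
  rewrite ?(gD, gM, g1, g0, ga, gN, hK).
- exact: maddA P _ _ _.
- exact: maddC P _ _.
- exact: maddx0 P _.
- exact: maddxN P _.
- exact: mmulA P _ _ _.
- exact: mmulC P _ _.
- exact: mmul1x P _.
- exact: mmulDr P _ _ _.
- exact: moppK P _.
- exact: mmulxV P _.
- exact: minvM P _ _.
- exact: minv1D0 P _.
- exact: minv0 P.
- exact: maddxa P _.
Qed.

(** The chosen representative has the index and coset of [c], so the two records differ only in
    their proof fields. *)
Lemma cls_cosetRepr (M : meadowOps) (I : set M) (c : cosetIn I) :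
  cls I (cosetRepr c) = Some c.
Proof.
rewrite /cosetRepr; case: c => z s [zP zK] sP /=.
case: cid2 => /= y ey es; rewrite /fiber /= in ey; subst z s.
rewrite /cls; case: pselect => // h.
by congr Some; congr CosetIn; exact: Prop_irrelevance.
Qed.

Section KernelQuotient.
Variables (M N : commonMeadow) (f : M -> N) (fhom : is_hom f).
Let PM := cmP M.
Let PN := cmP N.
Let I := KerR f.
Let hI : is_ideal I := KerR_ideal fhom.

Lemma hom_mul0 x : f (0 * x) = 0 * f x.
Proof. by rewrite (homM fhom) (hom_zero fhom). Qed.

Lemma collapsed_KerRP x : collapsed I (0 * x) <-> f x = \a.
Proof.
split=> [[_ e]|fx].
  have [+ _] : (I `&` fiber (0 * x))%classic (1 + 0 * x).
    by rewrite e /fiber /= (mmulDr PM) cm_mulx1 cm_mul00x cm_add0x.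
  rewrite /I /KerR /= (homD fhom) (hom1 fhom) hom_mul0 (mmulDr PN) cm_mulx1.
  by rewrite cm_mul00x cm_add0x => /cm_add1_mul0_eqa/cm_mul0x_eqa.
split; first by exists x.
apply/seteqP; split=> y; first by case.
move=> ey; split=> //; rewrite /fiber /= in ey.
(* The whole fiber is sent to [\a], and [\a = 0 * \a] puts it in the kernel. *)
have /cm_mul0x_eqa fy : 0 * f y = \a by rewrite -hom_mul0 ey hom_mul0 fx cm_mul0a.
by rewrite /I /KerR /= fy cm_mul0a.
Qed.

Definition quot_KerR_map (u : quot I) : N :=
  if u is Some c then f (cosetRepr c) else \a.

(** Independence of the representative: it is [x + i] with [i] in the kernel and [0 * i = 0 * x], so
    [f i = 0 * f x] is absorbed by [f x]. *)
Lemma quot_KerR_map_cls x : quot_KerR_map (cls I x) = f x.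
Proof.
case: (pselect (collapsed I (0 * x))) => hx.
  by rewrite cls_collapsed //=; apply/esym/collapsed_KerRP.
have [c -> [i [Ii ei] /= ->]] := cls_repr hI hx.
by rewrite (homD fhom) Ii -hom_mul0 ei hom_mul0 cm_add_x0x.
Qed.

Hypothesis fa : f \a = \a.

(** As [f \a = \a], even the extra point is a class, that of [\a]; identities in the quotient can
    thus be checked on classes. *)
Lemma cls_surj (u : quot I) : exists x, u = cls I x.
Proof.
case: u => [c|]; first by exists (cosetRepr c); rewrite cls_cosetRepr.
by exists \a; rewrite cls_collapsed //; exact/collapsed_KerRP.
Qed.

Lemma quot_KerR_map_hom : is_hom quot_KerR_map.
Proof.
split; last by rewrite [LHS]quot_KerR_map_cls (hom1 fhom).
- move=> u v; have [x ->] := cls_surj u; have [y ->] := cls_surj v.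
  rewrite !quot_KerR_map_cls.
  (* [cls_add] needs both indices uncollapsed; otherwise one class is the extra point and both sides
     become [\a]. *)
  case: (pselect (collapsed I (0 * x))) => hx.
    by rewrite cls_collapsed //=; move/collapsed_KerRP: hx => ->; rewrite cm_addax.
  case: (pselect (collapsed I (0 * y))) => hy.
    rewrite [cls I y]cls_collapsed //=; move/collapsed_KerRP: hy => ->.
    by rewrite (maddxa PN) /quot_op2; case: cls.
  by rewrite cls_add // quot_KerR_map_cls (homD fhom).
- move=> u v; have [x ->] := cls_surj u; have [y ->] := cls_surj v.
  rewrite !quot_KerR_map_cls.
  case: (pselect (collapsed I (0 * x))) => hx.
    by rewrite cls_collapsed //=; move/collapsed_KerRP: hx => ->; rewrite cm_mulax.
  case: (pselect (collapsed I (0 * y))) => hy.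
    rewrite [cls I y]cls_collapsed //=; move/collapsed_KerRP: hy => ->.
    by rewrite cm_mulxa /quot_op2; case: cls.
  by rewrite cls_mul // quot_KerR_map_cls (homM fhom).
Qed.

Lemma quot_KerR_map_opp u : quot_KerR_map (- u) = - quot_KerR_map u.
Proof.
have [x ->] := cls_surj u; rewrite quot_KerR_map_cls.
case: (pselect (collapsed I (0 * x))) => hx.
  by rewrite cls_collapsed //=; move/collapsed_KerRP: hx => ->; rewrite cm_oppa.
by rewrite cls_opp // quot_KerR_map_cls (hom_opp fhom).
Qed.

Lemma quot_KerR_map_inj : set_inj (zeros M) f -> injective quot_KerR_map.
Proof.
move=> finj u v; have [x ->] := cls_surj u; have [y ->] := cls_surj v.
rewrite !quot_KerR_map_cls => e.
have e0 : 0 * x = 0 * y.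
  by apply: finj; rewrite ?inE; [exists x|exists y|rewrite !hom_mul0 e].
apply: clsE => //.
have e1 : 0 * (x + - y) = 0 * y by rewrite (mmulDr PM) cm_mul0N e0 cm_add00.
(* [x] is [y] shifted by [x + - y], which lies in the fiber of [y] and in the kernel. *)
rewrite -(coset_shift hI (x := y) (i := x + - y)) //.
  by rewrite (maddC PM x) -(maddA PM) (maddxN PM) -e0 (maddC PM) cm_add_x0x.
rewrite /I /KerR /= (homD fhom) (hom_opp fhom) e (mmulDr PN) cm_mul0N cm_add00.
by rewrite (maddxN PN).
Qed.

End KernelQuotient.

(** If [f x = \a], then [f \a = f (x * \a) = \a * f \a = \a]. *)
Lemma surj_hom_err (M N : commonMeadow) (f : M -> N) :
  is_hom f -> (forall y, exists x, f x = y) -> f \a = \a.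
Proof.
move=> fhom fsurj; have [x fx] := fsurj \a.
by rewrite -(cm_mulxa x) (homM fhom) fx cm_mulax.
Qed.

Theorem corollary4p22 (M N : commonMeadow) (f : M -> N)
    (fhom : is_hom f)
    (fsurj : forall y : N, exists x : M, f x = y)
    (fL : zeros_order_iso f) :
  (exists inv : quot (KerR f) -> quot (KerR f), is_common_meadow inv) /\
  (exists fbar : quot (KerR f) -> N,
     [/\ forall x : M, ~ collapsed (KerR f) (0 * x) ->
           fbar (cls (KerR f) x) = f x,
         fbar \a = \a
       & is_iso fbar]).
Proof.
have fa := surj_hom_err _ _ _ fhom fsurj.
have clsf := quot_KerR_map_cls _ _ _ fhom.
have [[_ finj _] _] := fL.
have iso : is_iso (quot_KerR_map _ _ f).
  split; first exact: quot_KerR_map_hom.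
  (* A section [g] of [f] followed by [cls] is a right inverse, and by injectivity also a left
     inverse. *)
  have [g fg] := choice fsurj.
  exists (fun y => cls (KerR f) (g y)) => [u|y]; last by rewrite clsf fg.
  by apply: (quot_KerR_map_inj _ _ _ fhom fa finj); rewrite clsf fg.
split; last by exists (quot_KerR_map _ _ f); split=> // x _; exact: clsf.
apply: (transport_common_meadow _ _ _ iso) => //.
  by rewrite [LHS]clsf (hom_zero fhom).
exact: quot_KerR_map_opp.
Qed.
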